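(* Let $P=\operatorname{conv}\{\pm e_i: i\in[d]\}\subset\mathbb{R}^d$ be the cross-polytope. For any subsets $I,J\subseteq[d]$ the bisection cone $\mathcal{B}_{I,J}$ is the set of all $a\in\mathbb{R}^d$ satisfying the following inequalities: (i) $a_i\ge 0$ for all $i\in I\cap J^c$; (ii) $a_i\le 0$ for all $i\in J\cap I^c$; (iii) $a(J)\le a(J^c)$; (iv) $a(I^c)\le a(I)$.
   Context: $[d]=\{1,\dots,d\}$, $I^c=[d]\setminus I$, and $x(I)=\sum_{i\in I}x_i$ for $x\in\mathbb{R}^d$. The unit ball of the $\ell_1$-norm is the cross-polytope $P$, whose facets are $F_I=\operatorname{conv}(\{e_i:i\in I\}\cup\{-e_i:i\in I^c\})$ for $I\subseteq[d]$. The facet cones are the orthants $\operatorname{cone}(F_I)=\mathcal{O}_I=\{x\in\mathbb{R}^d: x_i\ge0\text{ for }i\in I,\ x_i\le0\text{ for }i\in I^c\}$. The bisector is $\operatorname{bis}(0,a)=\{x\in\mathbb{R}^d:\|x\|_1=\|x-a\|_1\}$, and the bisection cone is $\mathcal{B}_{I,J}=\{a\in\mathbb{R}^d:\operatorname{bis}(0,a)\cap\mathcal{O}_I\cap(\mathcal{O}_J+a)\neq\emptyset\}$. *)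

(* Defs.v *)
From mathcomp Require Import all_boot all_order all_algebra.
From mathcomp Require Import boolp classical_sets reals.
From mathcomp Require Import lra.

Set Implicit Arguments.
Unset Strict Implicit.
Unset Printing Implicit Defensive.

Import Order.TTheory GRing.Theory Num.Theory.

Local Open Scope classical_set_scope.
Local Open Scope ring_scope.

(* [d] is 'I_d, subsets of [d] are {set 'I_d} with complement ~: I, and
   vectors of R^d are rows, with coordinates x 0 i. *)

Section Definitions.
Variables (R : realType) (d : nat).
Implicit Types (x a : 'rV[R]_d) (I J : {set 'I_d}).

(* x(I) *)
Definition coord_sum x I : R := \sum_(i in I) x 0 i.

(* The library norm `|x| on rows is the sup norm, hence this definition. *)
Definition l1norm x : R := \sum_(i < d) `|x 0 i|.

Definition orthant I : set 'rV[R]_d :=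
  [set x | (forall i, i \in I -> 0 <= x 0 i) /\
           (forall i, i \in ~: I -> x 0 i <= 0)].

(* bis(0, a) *)
Definition bisector0 a : set 'rV[R]_d := [set x | l1norm x = l1norm (x - a)].

Definition bisection_cone I J : set 'rV[R]_d :=
  [set a | bisector0 a `&` orthant I `&` [set y + a | y in orthant J] !=set0].

Definition conv_hull (S : set 'rV[R]_d) : set 'rV[R]_d :=
  [set x | exists (T : finType) (c : T -> R) (v : T -> 'rV[R]_d),
    [/\ (forall t, 0 <= c t), \sum_t c t = 1, (forall t, S (v t))
      & x = \sum_t c t *: v t]].

Definition conic_hull (S : set 'rV[R]_d) : set 'rV[R]_d :=
  [set x | exists (T : finType) (c : T -> R) (v : T -> 'rV[R]_d),
    [/\ (forall t, 0 <= c t), (forall t, S (v t))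
      & x = \sum_t c t *: v t]].

Definition unit_vec (i : 'I_d) : 'rV[R]_d := delta_mx 0 i.

Definition cross_polytope : set 'rV[R]_d :=
  conv_hull ([set unit_vec i | i in [set: 'I_d]] `|`
             [set - unit_vec i | i in [set: 'I_d]]).

Definition cross_polytope_facet I : set 'rV[R]_d :=
  conv_hull ([set unit_vec i | i in [set` I]] `|`
             [set - unit_vec i | i in [set` ~: I]]).

End Definitions.

Arguments cross_polytope R d _ : clear implicits.

(* l1norm and orthant are not defined through the cross-polytope;
   cross_polytope_unit_ball and conic_hull_facet show that they have it
   as unit ball, resp. are the cones over its facets. *)

Section CrossPolytope.
Variables (R : realType) (d : nat).
Implicit Types (x : 'rV[R]_d) (I : {set 'I_d}).

Lemma sum_unit_vec (f : 'I_d -> R) (j : 'I_d) :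
  (\sum_i f i *: unit_vec R i) 0 j = f j.
Proof.
rewrite summxE (bigD1 j) //= big1 ?addr0 => [|i ij]; rewrite !mxE eqxx /=.
  by rewrite eqxx mulr1.
by rewrite eq_sym (negPf ij) mulr0.
Qed.

Lemma l1norm_unit_vec (i : 'I_d) : l1norm (unit_vec R i) = 1.
Proof.
rewrite /l1norm (bigD1 i) //= big1 ?addr0 => [|j ji]; rewrite !mxE eqxx /=.
  by rewrite eqxx normr1.
by rewrite (negPf ji) normr0.
Qed.

(* For d = 0 the convex hull is empty while the unit ball is a point. *)
Lemma cross_polytope_unit_ball : (0 < d)%N ->
  cross_polytope R d = [set x : 'rV[R]_d | l1norm x <= 1].
Proof.
move=> d0; apply/seteqP; split=> x /=.
  move=> [T [c [v [c0 c1 vP ->]]]].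
  have v1 t : l1norm (v t) = 1.
    case: (vP t) => -[i _ <-]; first exact: l1norm_unit_vec.
    rewrite -(l1norm_unit_vec i); apply: eq_bigr => j _.
    by rewrite [in LHS]mxE normrN.
  rewrite -c1 /l1norm.
  apply: (@le_trans _ _ (\sum_(i < d) \sum_t c t * `|v t 0 i|)).
    apply: ler_sum => i _; rewrite summxE.
    apply: le_trans (ler_norm_sum _ _ _) _.
    by apply: ler_sum => t _; rewrite mxE normrM ger0_norm.
  rewrite exchange_big /=; apply: ler_sum => t _.
  by rewrite -mulr_sumr -/(l1norm _) v1 mulr1.
move=> x1; have dn0 : (d%:R : R) != 0 by rewrite pnatr_eq0 -lt0n.
pose s (b : bool) : R := if b then -1 else 1.
pose k : R := (1 - l1norm x) / d%:R.
have k0 : 0 <= k by rewrite divr_ge0 ?ler0n // subr_ge0.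
pose c (t : 'I_d * bool) : R := (`|x 0 t.1| + s t.2 * x 0 t.1 + k) / 2.
exists ('I_d * bool)%type, c, (fun t => s t.2 *: unit_vec R t.1).
split.
- case=> i b; rewrite /c divr_ge0 //= addr_ge0 //.
  have := ler_norm (x 0 i); have := ler_norm (- x 0 i); rewrite normrN /s.
  by case: b; lra.
- rewrite -(pair_big xpredT xpredT (fun i b => c (i, b))) /=.
  transitivity (\sum_(i < d) (`|x 0 i| + k)).
    by apply: eq_bigr => i _; rewrite big_bool /c /s /=; lra.
  rewrite big_split /= sumr_const card_ord -/(l1norm x) -[k *+ d]mulr_natr.
  by rewrite divfK // addrC subrK.
- case=> i [] /=; rewrite /s ?scaleN1r ?scale1r.
    by right; exists i.
  by left; exists i.
- rewrite -(pair_big xpredT xpredT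
      (fun i b => c (i, b) *: (s b *: unit_vec R i))) /=.
  transitivity (\sum_i x 0 i *: unit_vec R i).
    by apply/rowP => j; rewrite sum_unit_vec.
  apply: eq_bigr => i _; rewrite big_bool /= !scalerA -scalerDl.
  by congr (_ *: _); rewrite /c /s /=; lra.
Qed.

Lemma orthant_conic I (T : finType) (c : T -> R) (v : T -> 'rV[R]_d) :
  (forall t, 0 <= c t) -> (forall t, orthant I (v t)) ->
  orthant I (\sum_t c t *: v t).
Proof.
move=> c0 vI; split=> i iI; rewrite summxE.
  by apply: sumr_ge0 => t _; rewrite mxE mulr_ge0 //; apply: (vI t).1.
by apply: sumr_le0 => t _; rewrite mxE mulr_ge0_le0 //; apply: (vI t).2.
Qed.

Lemma sub_conv_hull (S : set 'rV[R]_d) : S `<=` conv_hull S.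
Proof.
move=> x Sx; exists unit, (fun=> 1), (fun=> x).
by split=> //; rewrite big_const card_unit /= addr0 ?scale1r.
Qed.

Lemma conic_hull_facet I : conic_hull (cross_polytope_facet I) = orthant I :> set 'rV[R]_d.
Proof.
apply/seteqP; split=> x.
  move=> [T [c [v [c0 vI ->]]]]; apply: orthant_conic => // t.
  case: (vI t) => U [e [w [e0 _ wI ->]]]; apply: orthant_conic => // u.
  case: (wI u) => -[i /= iI <-]; split=> j jI; rewrite !mxE eqxx /=.
  - exact: ler0n.
  - by case: eqVneq jI => // ->; rewrite inE iI.
  - by case: eqVneq jI iI => [->|_ _ _]; rewrite ?oppr0 // inE => ->.
  - by rewrite oppr_le0 ler0n.
move=> [xI xIc].
exists 'I_d, (fun i => `|x 0 i|),
  (fun i => if i \in I then unit_vec R i else - unit_vec R i).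
split=> [//|i|].
  apply: sub_conv_hull; case: ifPn => iI; first by left; exists i.
  by right; exists i; rewrite //= inE.
transitivity (\sum_i x 0 i *: unit_vec R i).
  by apply/rowP => j; rewrite sum_unit_vec.
apply: eq_bigr => i _; case: ifPn => iI; first by rewrite ger0_norm ?xI.
by rewrite ler0_norm ?scalerN ?scaleNr ?opprK // xIc ?inE.
Qed.

End CrossPolytope.

(* Main.v *)
(* For x in O_I and x - a in O_J one has ||x||_1 = x(I) - x(I^c), while
   x(J) - x(J^c) <= ||x||_1, and likewise for x - a with I and J exchanged;
   subtracting gives
     a(J) - a(J^c) <= ||x||_1 - ||x - a||_1 <= a(I) - a(I^c),
   hence (iii) and (iv) when x lies on the bisector. Conversely, the point x
   equal to l a_i on the coordinates where I and J differ, to max(0, a_i) on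
   the intersection of I and J and to min(0, a_i) off their union attains
   ||x||_1 - ||x - a||_1 = (1 - l)(a(J) - a(J^c)) + l (a(I) - a(I^c)),
   which vanishes for a suitable l in [0, 1] by (iii) and (iv). *)
Require Import Defs.
From mathcomp Require Import all_boot all_order all_algebra.
From mathcomp Require Import boolp classical_sets reals.
From mathcomp Require Import ring lra.

Set Implicit Arguments.
Unset Strict Implicit.
Unset Printing Implicit Defensive.

Import Order.TTheory GRing.Theory Num.Theory.
Local Open Scope classical_set_scope.
Local Open Scope ring_scope.

Lemma convex_comb_eq0 (R : realFieldType) (m M : R) : m <= 0 -> 0 <= M ->
  exists l, [/\ 0 <= l, l <= 1 & (1 - l) * m + l * M = 0].
Proof.
move=> m0 M0; have [mM|mM] := eqVneq m M.
  by exists 0; split=> //; lra.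
have D0 : 0 < M - m by rewrite subr_gt0 lt_neqAle mM (le_trans m0).
exists (- m / (M - m)); split.
- by rewrite divr_ge0 ?oppr_ge0 // ltW.
- by rewrite ler_pdivrMr // mul1r lerDr.
- by field; rewrite gt_eqF.
Qed.

Section SignedSum.
Variables (R : realType) (d : nat).
Implicit Types (x a : 'rV[R]_d) (I J : {set 'I_d}).

(** The linear functional equal to [1] on every vertex of the facet $F_I$. *)
Definition signed_sum I x : R := coord_sum x I - coord_sum x (~: I).

Lemma signed_sumE I x :
  signed_sum I x = \sum_i if i \in I then x 0 i else - x 0 i.
Proof.
rewrite [RHS](bigID (mem I)) /= /signed_sum /coord_sum -sumrN.
congr (_ + _); first by apply: eq_bigr => i ->.
by apply: eq_big => [i|i]; rewrite inE // => /negPf ->.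
Qed.

Lemma signed_sumB I x a : signed_sum I (x - a) = signed_sum I x - signed_sum I a.
Proof.
rewrite !signed_sumE -sumrB; apply: eq_bigr => i _.
by rewrite !mxE; case: ifP => _; ring.
Qed.

Lemma signed_sum_le_l1norm I x : signed_sum I x <= l1norm x.
Proof.
rewrite signed_sumE; apply: ler_sum => i _.
by case: ifP => _; rewrite ?ler_norm // -normrN ler_norm.
Qed.

Lemma l1norm_orthant I x : orthant I x -> l1norm x = signed_sum I x.
Proof.
move=> [xI xIc]; rewrite signed_sumE; apply: eq_bigr => i _.
case: ifPn => iI; first by rewrite ger0_norm ?xI.
by rewrite ler0_norm ?xIc // inE.
Qed.

Definition bisecting_point I J a (l : R) : 'rV[R]_d :=
  \row_i (if (i \in I) == (i \in J) then
            if i \in I then Num.max 0 (a 0 i) else Num.min 0 (a 0 i)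
          else l * a 0 i).

(** Needs no sign condition: where [I] and [J] agree, the coordinate of the point cancels, so the
    max and min never matter. *)
Lemma signed_sum_bisecting_point I J a l :
  signed_sum I (bisecting_point I J a l)
    - signed_sum J (bisecting_point I J a l - a)
  = (1 - l) * signed_sum J a + l * signed_sum I a.
Proof.
rewrite !signed_sumE -sumrB !mulr_sumr -big_split; apply: eq_bigr => i _.
by rewrite !mxE; case: (i \in I); case: (i \in J) => /=; ring.
Qed.

(** Where [I] and [J] differ, [l * a_i] and [l * a_i - a_i] have opposite signs, as required; where
    they agree, the max or min gives both the same sign. *)
Lemma bisecting_point_orthants I J a l : 0 <= l -> l <= 1 ->
  (forall i, i \in I :&: ~: J -> 0 <= a 0 i) ->
  (forall i, i \in J :&: ~: I -> a 0 i <= 0) ->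
  orthant I (bisecting_point I J a l) /\
  orthant J (bisecting_point I J a l - a).
Proof.
move=> l0 l1 aIJ aJI.
by split; split=> i; move: (aIJ i) (aJI i); rewrite !mxE !inE;
  case: (i \in I); case: (i \in J) => //= H1 H2 _;
  rewrite ?subr_ge0 ?subr_le0 ?le_max ?ge_min ?lexx ?orbT //;
  try (have {}H1 := H1 isT); try (have {}H2 := H2 isT); nra.
Qed.

End SignedSum.

Theorem proposition6p1 (R : realType) (d : nat) (I J : {set 'I_d}) :
  bisection_cone I J =
  [set a : 'rV[R]_d |
    [/\ (forall i, i \in I :&: ~: J -> 0 <= a 0 i),
        (forall i, i \in J :&: ~: I -> a 0 i <= 0),
        coord_sum a J <= coord_sum a (~: J)
      & coord_sum a (~: I) <= coord_sum a I]].
Proof.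
apply/seteqP; split=> a.
  move=> [x [[/= bis xI] [y yJ yx]]].
  have {}bis : l1norm x = l1norm (x - a) := bis.
  have {}yx : y = x - a by rewrite -yx addrK.
  rewrite yx in yJ.
  have [[xI0 xIc0] [yJ0 yJc0]] := (xI, yJ); split=> [i|i||].
  - rewrite inE => /andP[iI iJ]; move: (xI0 i iI) (yJc0 i iJ).
    by rewrite !mxE; lra.
  - rewrite inE => /andP[iJ iI]; move: (xIc0 i iI) (yJ0 i iJ).
    by rewrite !mxE; lra.
  (* Both sides of [signed_sum J x <= l1norm x] contain [signed_sum J x], as
     [l1norm x = l1norm (x - a)] and [x - a] lies in [orthant J]. *)
  - rewrite -subr_le0 -/(signed_sum _ _).
    have := signed_sum_le_l1norm J x.
    by rewrite bis (l1norm_orthant yJ) signed_sumB; lra.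
  - rewrite -subr_ge0 -/(signed_sum _ _).
    have := signed_sum_le_l1norm I (x - a).
    by rewrite -bis (l1norm_orthant xI) signed_sumB; lra.
move=> [aIJ aJI]; rewrite -subr_le0 -/(signed_sum _ _) => aJ.
rewrite -subr_ge0 -/(signed_sum _ _) => aI.
have [l [l0 l1 l_eq0]] := convex_comb_eq0 aJ aI.
have [xI yJ] := bisecting_point_orthants l0 l1 aIJ aJI.
exists (bisecting_point I J a l); split; last first.
  by exists (bisecting_point I J a l - a); rewrite ?subrK.
split=> //=; apply/subr0_eq.
by rewrite (l1norm_orthant xI) (l1norm_orthant yJ) signed_sum_bisecting_point.
Qed.
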